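(* Let $\mathcal{M}$ be the class of all substitution minimal subshifts, i.e. of all subshifts of the form $(X_\sigma,T)$, with $\sigma$ a substitution, that are minimal. Let $\mathcal{M}'$ be the class of all $(X_{\sigma},T)$ such that $\sigma$ is a substitution that is tame and $l$-primitive. Then $\mathcal{M} = \mathcal{M}'$.
   Context: An alphabet $A$ is a nonempty finite set; the case in which $A$ consists of a single element is excluded, so every alphabet has at least two elements. Its elements are letters. $A^+$ is the set of all words over $A$ of positive finite length, $\epsilon$ is the empty word, $A^* = A^+ \cup \{\epsilon\}$, and $|w|$ is the length of $w$. A word $v$ is a subword (factor) of $w$ if $w = u v u'$ for some $u,u' \in A^*$. A map $\sigma : A \to A^+$ extends to $\sigma : A^* \to A^*$ by concatenation and $\sigma(\epsilon)=\epsilon$. Put $A_l := \{a \in A : \lim_{n\to\infty} |\sigma^n(a)| = \infty\}$ and $A_s := A \setminus A_l$. A letter $b \in A$ is isolated if $b \in A_s$ and $b$ does not appear in any $\sigma^n(a)$ with $a \in A_l$, $n \ge 1$; $A_{\mathrm{iso}}$ is the set of isolated letters. The map $\sigma$ is called a substitution if $A_l \ne \emptyset$ and $A_{\mathrm{iso}} = \emptyset$. The language $\mathcal{L}(\sigma) \subseteq A^*$ is the set of all words that are subwords of $\sigma^n(a)$ for some $a \in A$ and $n \ge 1$. For $x \in A^{\mathbb{Z}}$ and integers $s < t$, $x[s,t] := x(s)x(s+1)\cdots x(t)$. Define $X_\sigma := \{x \in A^{\mathbb{Z}} : x[s,t] \in \mathcal{L}(\sigma) \text{ for all integers } s<t\}$.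 $T$ is the left shift on two-sided sequences; a subshift is a closed set $\Lambda \subseteq A^{\mathbb{Z}}$ (product topology) with $T(\Lambda)=\Lambda$, written $(\Lambda,T)$. A subshift is minimal if it contains no nonempty proper subshift. Two subshifts are regarded as equal if they are the same set of two-sided sequences (for $B \subseteq A$, $B^{\mathbb{Z}}$ is regarded as a subset of $A^{\mathbb{Z}}$); the substitution generating a member of $\mathcal{M}$ and the one generating it as a member of $\mathcal{M}'$ may be different and may be defined on different alphabets. A substitution $\sigma$ is $l$-primitive if there exists $n \ge 1$ such that for all $a,b \in A_l$, $a$ is a letter in $\sigma^n(b)$. A letter $a \in A_l$ is left-isolated if there is $n \ge 1$ with $\sigma^n(a) = u\,a\,w$ for some $u \in A_s^+$ and $w \in A^*$; it is right-isolated if there is $n \ge 1$ with $\sigma^n(a) = w\,a\,u$ for some $w \in A^*$ and $u \in A_s^+$ (here $A_s^+$ is the set of nonempty words over $A_s$). A substitution $\sigma$ is tame if no letter in $A_l$ is left-isolated and no letter in $A_l$ is right-isolated.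
   Formalization: One-point subshifts {b^Z} are removed from M: since alphabets have at least two letters, a -> ab, b -> b puts {b^Z} in M, but it is never in M', because every letter occurs in X_σ when σ is tame and l-primitive. *)

(* Defs.v *)
From HB Require Import structures.
From mathcomp Require Import all_boot all_order all_algebra finmap.
From mathcomp Require Import all_classical all_analysis.
Set Implicit Arguments.
Unset Strict Implicit.
Unset Printing Implicit Defensive.
Import GRing.Theory.
Local Open Scope nat_scope.
Local Open Scope classical_set_scope.

Section Substitutions.
Variables (A : finType) (sigma : A -> seq A).

Definition subst_ext (w : seq A) : seq A := flatten (map sigma w).

Definition subst_iter (n : nat) (a : A) : seq A := iter n subst_ext [:: a].

Definition letters_l : set A :=
  [set a | size (subst_iter n a) @[n --> \oo] --> \oo].

Definition letters_s : set A := ~` letters_l.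

Definition word_s (u : seq A) : Prop := forall c, c \in u -> letters_s c.

Definition letters_iso : set A :=
  [set b | letters_s b /\
     forall a n, letters_l a -> 1 <= n -> b \notin subst_iter n a].

Definition substitution : Prop :=
  [/\ forall a, sigma a != [::], letters_l !=set0 & letters_iso = set0].

Definition language : set (seq A) :=
  [set w | exists a n, 1 <= n /\ infix w (subst_iter n a)].

Definition l_primitive : Prop :=
  exists2 n, 1 <= n &
    forall a b, letters_l a -> letters_l b -> a \in subst_iter n b.

Definition left_isolated (a : A) : Prop :=
  exists n u w, [/\ 1 <= n, u != [::], word_s u & subst_iter n a = u ++ a :: w].

Definition right_isolated (a : A) : Prop :=
  exists n w u, [/\ 1 <= n, u != [::], word_s u & subst_iter n a = w ++ a :: u].

Definition tame : Prop :=
  forall a, letters_l a -> ~ left_isolated a /\ ~ right_isolated a.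

End Substitutions.

(* x[s,t]; only meaningful for s <= t *)
Definition factor (A : Type) (x : int -> A) (s t : int) : seq A :=
  [seq x (s + k%:Z)%R | k <- iota 0 `|t - s|%N.+1].

Definition X_subst (A : finType) (sigma : A -> seq A) : set (int -> A) :=
  [set x | forall s t : int, (s < t)%R -> language sigma (factor x s t)].

Definition shift (A : Type) (x : int -> A) : int -> A := fun i => x (i + 1)%R.

Definition full_shift (A : choiceType) : Type :=
  prod_topology (fun _ : int => discrete_topology A).
HB.instance Definition _ (A : choiceType) := Topological.on (full_shift A).

Definition subshift (A : finType) (L : set (int -> A)) : Prop :=
  closed (L : set (full_shift A)) /\ @shift A @` L = L.

Definition minimal_subshift (A : finType) (L : set (int -> A)) : Prop :=
  subshift L /\
  forall L' : set (int -> A), subshift L' -> L' !=set0 -> L' `<=` L -> L' = L.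

(* Letters of all alphabets are drawn from a common type U, an alphabet being a
   finite A : {fset U} with at least two elements; embed realises the inclusion
   of A^Z in U^Z, so that subshifts over different alphabets are compared as
   sets of two-sided sequences. *)
Definition embed (U : choiceType) (A : {fset U}) (x : int -> A) : int -> U :=
  fun i => val (x i).

Definition substitution_minimal_subshifts (U : choiceType) :
    set (set (int -> U)) :=
  [set L | exists (A : {fset U}) (sigma : A -> seq A),
     [/\ 1 < #|` A|, substitution sigma, minimal_subshift (X_subst sigma) &
         L = @embed U A @` X_subst sigma]].

Definition tame_l_primitive_subshifts (U : choiceType) :
    set (set (int -> U)) :=
  [set L | exists (A : {fset U}) (sigma : A -> seq A),
     [/\ 1 < #|` A|, substitution sigma, tame sigma, l_primitive sigma &
         L = @embed U A @` X_subst sigma]].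

(* The subshifts contained in {b}^Z for a single letter b.  They have to be set
   apart when one-letter alphabets are excluded: a |-> ab, b |-> b generates the
   minimal subshift {b^Z}, whereas for a tame l-primitive substitution on at
   least two letters every letter occurs in X_subst. *)
Definition one_letter_subshifts (U : choiceType) : set (set (int -> U)) :=
  [set L | exists b : U, forall x, L x -> forall i, x i = b].

Arguments substitution_minimal_subshifts : clear implicits.
Arguments tame_l_primitive_subshifts : clear implicits.
Arguments one_letter_subshifts : clear implicits.

(* Main.v *)
Require Import Defs.
From mathcomp Require Import all_boot all_order all_algebra finmap.
From mathcomp Require Import all_classical all_analysis.
From mathcomp Require Import zify.
(* mathcomp-analysis exports another [factor]. *)
Import Defs.

(* Call a letter growing if it lies in [letters_l].  If sigma is tame, the
   words of the language without growing letters have bounded length; with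
   l-primitivity, every long word of the language then contains any given
   [sigma^m(a)], a growing, so X_sigma is minimal, and every letter occurs in it.

   Conversely, restrict a power of sigma to a class C of growing letters, minimal
   for an idempotent power of the relation "occurs in the image of", together
   with the letters occurring in images of C.  This gives an l-primitive tau with
   X_tau inside X_sigma.  If tau is tame, X_tau is nonempty, hence equal to
   X_sigma.  If not, iterating tau on an isolated letter produces arbitrarily high
   powers of a word v, so by minimality X_sigma is the orbit of the periodic
   sequence v^oo, which the substitution mapping every letter of v to v
   generates. *)

Set Implicit Arguments.
Unset Strict Implicit.
Unset Printing Implicit Defensive.
Import Order.TTheory GRing.Theory Num.Theory.
Local Open Scope nat_scope.
Local Open Scope classical_set_scope.

(** * Subshifts and windows *)

Definition window (T : Type) (x : int -> T) (s : int) (n : nat) : seq T :=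
  mkseq (fun k => x (s + k%:Z)%R) n.

(** [X_subst sigma] is [X_of (language sigma)] by conversion; an arbitrary word set also covers
    periodic sequences and images in [U]. *)
Definition X_of (T : Type) (W : set (seq T)) : set (int -> T) :=
  [set x | forall s t : int, (s < t)%R -> W (factor x s t)].

Lemma window_factor (T : Type) (x : int -> T) (s : int) (n : nat) :
  window x s n.+1 = factor x s (s + n%:Z)%R.
Proof. by rewrite /factor addrC addKr. Qed.

(** Lengths start at two because the defining condition only concerns [s < t]. *)
Lemma X_ofP (T : Type) (W : set (seq T)) (x : int -> T) :
  X_of W x <-> forall s n, W (window x s n.+2).
Proof.
split=> [Wx s n|Wx s t lt_st].
  by rewrite window_factor; apply: Wx; rewrite ltrDl.
have [m ->] : exists m : nat, t = (s + m.+1%:Z)%R.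
  by exists `|t - s|%N.-1; lia.
by rewrite -window_factor; exact: Wx.
Qed.

Lemma window_shift (T : Type) (x : int -> T) (s r : int) (n : nat) :
  window (fun i => x (i + r)%R) s n = window x (s + r)%R n.
Proof. by apply: eq_map => k; rewrite addrAC. Qed.

Lemma window_map (T T' : Type) (f : T -> T') (x : int -> T) s n :
  window (f \o x) s n = map f (window x s n).
Proof. by rewrite /window /mkseq -map_comp. Qed.

Lemma windowD (T : Type) (x : int -> T) s m n :
  window x s (m + n) = window x s m ++ window x (s + m%:Z)%R n.
Proof.
rewrite /window /mkseq iotaD map_cat; congr (_ ++ _).
rewrite add0n -[in iota m n](addn0 m) iotaDl -map_comp; apply: eq_map => k /=.
by rewrite PoszD addrA.
Qed.

Lemma infix_window (T : eqType) (x : int -> T) s m n w :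
  infix w (window x s n) -> size w = m ->
  exists i : nat, i + m <= n /\ w = window x (s + i%:Z)%R m.
Proof.
move=> /infixP[p [q E]] szw; exists (size p).
have szn : n = size p + (m + size q).
  by have := congr1 size E; rewrite size_mkseq !size_cat szw.
split; first by lia.
move: E; rewrite szn windowD => /eqP.
rewrite eqseq_cat ?size_mkseq // => /andP[_ /eqP].
by rewrite windowD => /eqP; rewrite eqseq_cat ?size_mkseq // => /andP[/eqP->].
Qed.

Section Cylinders.
Variable A : finType.
Implicit Types (L : set (int -> A)) (W : set (seq A)).

Lemma closed_windowP L :
  closed (L : set (full_shift A)) <->
  forall y, (forall s n, exists2 x, L x & window x s n = window y s n) -> L y.
Proof.
split=> [cL y yP|H y cly].
  (* The approximants [g n] agree with [y] on [-n, n), hence converge to [y] coordinatewise. *)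
  have /choice[g gP] : forall n : nat, exists x : int -> A,
      L x /\ window x (- n%:Z)%R (n + n) = window y (- n%:Z)%R (n + n).
    by move=> n; have [x Lx e] := yP (- n%:Z)%R (n + n); exists x.
  apply: cL => B; suff gcvg : (g : nat -> full_shift A) @ \oo --> (y : full_shift A).
    move=> /gcvg; rewrite nbhs_simpl => -[N _ gB].
    by exists (g N); split; [case: (gP N)|apply: gB => /=].
  apply/cvg_sup => i V [V'] [[Z] oZ <-] /= Zy ZV.
  apply: (filterS ZV); rewrite nbhs_simpl; exists (`|i|%N.+1) => // n /= le_n.
  have [_ /(congr1 (fun s => nth (y 0%R) s (absz (i + n%:Z)%R)))] := gP n.
  rewrite !nth_mkseq; [|by lia..].
  have -> : (- n%:Z + (absz (i + n%:Z)%R)%:Z)%R = i by lia.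
  by move=> ->.
apply: H => s n.
have [|x [Lx xP]] := cly [set x | window x s n = window y s n].
  (* Agreement on a window is a finite intersection of coordinate conditions, each a neighbourhood
     because the alphabet is discrete. *)
  pose C (k : nat) := [set x : full_shift A | x (s + k%:Z)%R = y (s + k%:Z)%R].
  have nC k : nbhs (y : full_shift A) (C k).
    exact: (@proj_continuous int (fun _ => discrete_topology A) (s + k%:Z)%R y
      [set y (s + k%:Z)%R] (@discrete_set1 (discrete_topology A) _)).
  elim: n => [|n IH]; first by apply: filterS filterT.
  apply: filterS (filterI IH (nC n)) => x [/= xn xC].
  by rewrite -addn1 !windowD xn /window /mkseq /= addr0 xC.
by exists x.
Qed.

Lemma subshift_X_of W : subshift (X_of W).
Proof.
split.
  apply/closed_windowP => y yP; apply/X_ofP => s n.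
  by have [x /X_ofP Wx <-] := yP s n.+2; exact: Wx.
apply/seteqP; split=> [_ [x /X_ofP Wx <-]|x /X_ofP Wx].
  by apply/X_ofP => s n; rewrite window_shift.
exists (fun i => x (i + -1)%R); last by apply/funext => i; rewrite /shift addrK.
by apply/X_ofP => s n; rewrite window_shift.
Qed.

Lemma subshift_translate L x (r : int) :
  subshift L -> L x -> L (fun i => x (i + r)%R).
Proof.
move=> [_ sL] Lx.
have fwd (n : nat) y : L y -> L (fun i => y (i + n%:Z)%R).
  move=> Ly; elim: n => [|n IH].
    by rewrite (_ : (fun _ => _) = y) //; apply/funext => i; rewrite addr0.
  rewrite -sL; exists (fun i => y (i + n%:Z)%R) => //.
  by apply/funext => i; rewrite /shift; congr y; lia.
have bwd (n : nat) y : L y -> L (fun i => y (i - n%:Z)%R).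
  move=> Ly; elim: n => [|n IH].
    by rewrite (_ : (fun _ => _) = y) //; apply/funext => i; rewrite subr0.
  (* Surjectivity of the shift on [L] gives a preimage [z]; injectivity identifies it with the
     translate. *)
  move: IH; rewrite -{1}sL => -[z Lz zE].
  rewrite (_ : (fun _ => _) = z) //; apply/funext => i.
  have := congr1 (fun f => f (i - 1)%R) zE; rewrite /shift subrK => ->.
  by congr y; lia.
case: r => n; first exact: fwd.
by rewrite NegzE; exact: bwd.
Qed.

(* [x] is the limit, along an ultrafilter, of bi-infinite extensions of the words
   [p ++ c :: q] centred at [c]. *)
Lemma X_of_extend W (c : A) :
  (forall u v, infix u v -> W v -> W u) ->
  (forall K, exists p q, [/\ W (p ++ c :: q), K <= size p & K <= size q]) ->
  exists2 x, X_of W x & x 0%R = c.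
Proof.
move=> Winf /choice[p /choice[q pqP]].
(* Coordinate 0 reads the central [c]. Values read outside the word, through the default or [absz]
   of a negative index, are junk that large [K] pushes out of any given window. *)
pose g (K : nat) (i : int) := nth c (p K ++ c :: q K) (absz ((size (p K))%:Z + i)%R).
have [G [UG sG]] := ultraFilterLemma (@eventually_filter).
(* Otherwise the ultrafilter would contain the complements of the finitely many level sets, and so
   their empty intersection. *)
have GP (i : int) : exists a, G [set K | g K i = a].
  apply: contrapT => /forallNP nG.
  have : \forall K \near G, forall a, g K i <> a.
    apply: filter_forall => a.
    by have [/nG|] := in_ultra_setVsetC [set K | g K i = a] UG.
  by move=> /filter_ex[K /(_ (g K i))].
have [x xP] := choice GP.
have xw s n : \forall K \near G, window (g K) s n = window x s n.
  elim: n => [|n IH]; first by apply: filterS filterT.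
  apply: filterS (filterI IH (xP (s + n%:Z)%R)) => K [/= Kn KC].
  by rewrite -addn1 !windowD Kn /window /mkseq /= addr0 KC.
exists x; last first.
  have [K <-] := filter_ex (xP 0%R).
  by rewrite /g addr0 absz_nat nth_cat ltnn subnn.
apply/X_ofP => s n.
have big : G [set K | `|s|%N + n.+2 <= K] by apply: sG; exists (`|s|%N + n.+2).
have [K [/= <- bigK]] := filter_ex (filterI (xw s n.+2) big).
have [WK pK qK] := pqP K; apply: Winf WK.
set w := p K ++ c :: q K.
have szw : size w = size (p K) + (size (q K)).+1 by rewrite size_cat.
have -> : window (g K) s n.+2 = take n.+2 (drop (absz ((size (p K))%:Z + s)%R) w).
  apply: (@eq_from_nth _ c) => [|i].
    by rewrite size_mkseq size_takel // size_drop; lia.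
  rewrite size_mkseq => lt_i; rewrite nth_mkseq // nth_take // nth_drop /g.
  by congr nth; lia.
by apply: infix_trans (infix_take _ _) (infix_drop _ _).
Qed.

End Cylinders.

(** * Comparing subshifts over different alphabets *)

Section Embedding.
Variables (U : choiceType) (A : {fset U}).

Lemma window_embed (x : int -> A) s n :
  window (embed x) s n = map val (window x s n).
Proof. exact: window_map. Qed.

Lemma embed_X_of (W : set (seq A)) :
  @embed U A @` X_of W = X_of (map val @` W).
Proof.
apply/seteqP; split=> [_ [x /X_ofP Wx <-]|x /X_ofP Wx].
  by apply/X_ofP => s n; rewrite window_embed; exists (window x s n.+2).
have /choice[y yP] : forall i, exists a : A, val a = x i.
  move=> i; have [w _] := Wx i 0; case: w => // a w [e _].
  by exists a; apply: etrans e _; rewrite addr0.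
have xE : embed y = x by apply/funext.
exists y => //; apply/X_ofP => s n.
have [w Ww] := Wx s n; rewrite -xE window_embed => /inj_map.
by move=> /(_ val_inj) <-.
Qed.

(** Pulled back to [A], the right-hand side is a nonempty subshift inside [X_subst sigma], so
    minimality forces equality. Both cases of the converse end with this. *)
Lemma minimal_embedE (sigma : A -> seq A) (W : set (seq U)) :
  minimal_subshift (X_subst sigma) ->
  W `<=` map val @` language sigma -> X_of W !=set0 ->
  @embed U A @` X_subst sigma = X_of W.
Proof.
move=> [_ min] sW [x WX].
pose W' : set (seq A) := [set w | W (map val w)].
have WE : W = map val @` W'.
  apply/seteqP; split=> [w Ww|_ [w Ww <-]] //.
  by have [v _ vw] := sW w Ww; exists v => //; rewrite /W' /= vw.
rewrite WE -embed_X_of; congr (_ @` _); apply/esym/min.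
- exact: subshift_X_of.
- by move: WX; rewrite WE -embed_X_of => -[y Wy _]; exists y.
- move=> y Wy s t st; have /sW[v Lv /inj_map] := Wy s t st.
  by move=> /(_ val_inj) <-.
Qed.

End Embedding.

(** * Growing and bounded letters *)

Lemma uniform_bound (T : finType) (Q : T -> nat -> Prop) :
  (forall a m n, m <= n -> Q a m -> Q a n) -> (forall a, exists n, Q a n) ->
  exists n, forall a, Q a n.
Proof.
move=> mQ /choice[f fQ]; exists (\max_a f a) => a.
by apply: mQ (fQ a); exact: leq_bigmax.
Qed.

Lemma nat_fin_collision (T : finType) (f : nat -> T) : exists i j, i < j /\ f i = f j.
Proof.
have : ~~ injectiveb (fun i : 'I_(#|T|.+1) => f i).
  apply/negP => /injectiveP/leq_card; rewrite card_ord ltnn //.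
move=> /injectivePn[i [j + fij]]; rewrite -val_eqE neq_ltn => /orP[ij|ji].
  by exists i, j.
by exists j, i.
Qed.

Lemma cat_eq_prefix (T : Type) (y z p r : seq T) :
  y ++ z = p ++ r -> size y <= size p -> exists s, p = y ++ s /\ z = s ++ r.
Proof.
elim: y p => [|c y IH] p /=; first by move=> ->; exists p.
by case: p => // d p [-> /IH h] /h[s [-> ->]]; exists s.
Qed.

Lemma infix_catE (T : Type) (p w q y z : seq T) :
  p ++ w ++ q = y ++ z ->
  [\/ exists r, y = p ++ w ++ r,
      exists r, z = r ++ w ++ q |
      exists w1 w2, [/\ w = w1 ++ w2, y = p ++ w1 & z = w2 ++ q]].
Proof.
move=> E; have [le_yp|/ltnW lt_py] := leqP (size y) (size p).
  by have [r [_ ->]] := cat_eq_prefix (esym E) le_yp; constructor 2; exists r.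
have [r [-> wE]] := cat_eq_prefix E lt_py.
have [le_rw|/ltnW le_wr] := leqP (size r) (size w).
  have [s [-> ->]] := cat_eq_prefix (esym wE) le_rw.
  by constructor 3; exists r, s.
by have [s [-> _]] := cat_eq_prefix wE le_wr; constructor 1; exists s.
Qed.

(** Take for [z1] the shortest prefix whose image covers [p]: the overshoot [p'] then lies within
    the image of one letter. *)
Lemma flatten_prefix_cut (A T : Type) (g : A -> seq T) M z p r :
  (forall a, size (g a) <= M) -> flatten (map g z) = p ++ r ->
  exists z1 z2 p', [/\ z = z1 ++ z2, flatten (map g z1) = p ++ p' & size p' <= M].
Proof.
move=> gM; elim: z p => [|c z IH] p /=.
  by case: p => // _; exists [::], [::], [::].
move=> E; have [le_cp|/ltnW lt_pc] := leqP (size (g c)) (size p).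
  have [s [-> /IH[z1 [z2 [p' [-> zE szp']]]]]] := cat_eq_prefix E le_cp.
  by exists (c :: z1), z2, p'; rewrite /= zE catA.
have [s [cE _]] := cat_eq_prefix (esym E) lt_pc.
exists [:: c], z, s; split=> //=; first by rewrite cats0.
by apply: leq_trans (gM c); rewrite cE size_cat leq_addl.
Qed.

(* Desubstitution: a long factor of [g(z)] contains the image of a factor of
   [z] of prescribed length. *)
Lemma infix_desubst (A T : eqType) (g : A -> seq T) M N z w :
  (forall a, size (g a) <= M) -> infix w (flatten (map g z)) ->
  M * N.+1 < size w ->
  exists z', [/\ infix z' z, size z' = N & infix (flatten (map g z')) w].
Proof.
move=> gM /infixP[p [q E]] szw.
have [z1 [z2 [p' [zE z1E szp']]]] := flatten_prefix_cut gM E.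
have szf s : size (flatten (map g s)) <= M * size s.
  elim: s => //= a s IH; rewrite size_cat mulnS; exact: leq_add.
have E2 : p' ++ flatten (map g z2) = w ++ q.
  move: E; rewrite zE map_cat flatten_cat z1E -catA => /eqP.
  by rewrite eqseq_cat // => /andP[_ /eqP].
(* Dropping the overshoot costs at most [M] letters of [w], which accounts for [N.+1] instead of [N]
   in the hypothesis. *)
have [|w' [wE {}E2]] := cat_eq_prefix E2; first by apply: leq_trans szp' _; lia.
have szw' : M * N < size w' by have := congr1 size wE; rewrite size_cat; lia.
have leN : N <= size z2.
  have := szf z2; rewrite E2 size_cat => h.
  rewrite leqNgt; apply/negP => lt_N.
  have : M * size z2 <= M * N by rewrite leq_mul2l ltnW ?orbT.
  lia.
exists (take N z2); split.
- rewrite zE; apply: infix_catl; exact: infix_take.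
- by rewrite size_takel.
have szt : size (flatten (map g (take N z2))) <= size w'.
  by apply: leq_trans (szf _) _; rewrite size_takel // ltnW.
move: E2; rewrite -{1}(cat_take_drop N z2) map_cat flatten_cat.
move=> /cat_eq_prefix/(_ szt)[s [w'E _]].
by rewrite wE w'E infix_infix.
Qed.

Section Words.
Variables (A : finType) (sigma : A -> seq A).
Hypothesis sigma_ne : forall a, sigma a != [::].
Local Notation ext n w := (iter n (subst_ext sigma) w).
Local Notation sit n a := (subst_iter sigma n a).
Local Notation isL := (letters_l sigma).
Local Notation isS := (letters_s sigma).
Local Notation word_s := (word_s sigma).

Lemma ext_flatten n w : ext n w = flatten (map (subst_iter sigma n) w).
Proof.
elim: n => [|n IH] /=.
  by elim: w => //= a w {1}->.
rewrite {}IH; elim: w => //= a w IHw.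
by rewrite -IHw /subst_ext map_cat flatten_cat.
Qed.

Lemma ext_cat n u v : ext n (u ++ v) = ext n u ++ ext n v.
Proof. by rewrite !ext_flatten map_cat flatten_cat. Qed.

Lemma ext_nil n : ext n [::] = [::].
Proof. by rewrite ext_flatten. Qed.

Lemma ext_cons n a v : ext n (a :: v) = sit n a ++ ext n v.
Proof. by rewrite !ext_flatten. Qed.

Lemma sitD m n a : sit (m + n) a = ext m (sit n a).
Proof. by rewrite /subst_iter iterD. Qed.

Lemma size_ext_ge n w : size w <= size (ext n w).
Proof.
elim: n => //= n IH; apply: leq_trans IH _.
elim: (ext n w) => //= a s IH; rewrite /subst_ext /= size_cat -add1n.
by apply: leq_add IH; rewrite lt0n size_eq0.
Qed.

Lemma size_sit_le m n a : m <= n -> size (sit m a) <= size (sit n a).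
Proof. by move=> /subnK <-; rewrite sitD; exact: size_ext_ge. Qed.

Lemma ext_nil_eq n w : ext n w = [::] -> w = [::].
Proof. by move=> e; apply/nilP; rewrite /nilp -leqn0; have := size_ext_ge n w; rewrite e. Qed.

Lemma mem_ext n w c : c \in ext n w <-> exists2 d, d \in w & c \in sit n d.
Proof.
rewrite ext_flatten; split=> [/flatten_mapP[d dw cd]|[d dw cd]]; first by exists d.
by apply/flatten_mapP; exists d.
Qed.

Lemma infix_ext n u v : infix u v -> infix (ext n u) (ext n v).
Proof. by move=> /infixP[p [q ->]]; rewrite !ext_cat infix_infix. Qed.

Lemma prefix_ext n u v : prefix u v -> prefix (ext n u) (ext n v).
Proof. by move=> /prefixP[q ->]; rewrite ext_cat prefix_prefix. Qed.

Lemma infix_sit n c w : c \in w -> infix (sit n c) (ext n w).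
Proof. by rewrite -infix1s => /(infix_ext n). Qed.

(** No image is empty, so lengths are nondecreasing in [n] and divergence amounts to
    unboundedness. *)
Lemma letters_lP a : isL a <-> forall N, exists n, N <= size (sit n a).
Proof.
split=> [aL N|H].
  have [n _ Nn] := aL _ (nbhs_infty_ge N).
  by exists n; exact: (Nn n (leqnn n)).
move=> P [N _ NP]; have [n nN] := H N.
by exists n => // m /= nm; apply/NP/(leq_trans nN)/size_sit_le.
Qed.

Lemma letters_sP a : isS a <-> exists B, forall n, size (sit n a) <= B.
Proof.
split=> [aS|[B aB] /letters_lP/(_ B.+1)[n]]; last by rewrite ltnNge aB.
apply: contrapT => /forallNP nB; apply: aS; apply/letters_lP => N.
have /existsNP[n /negP] := nB N; rewrite -ltnNge => /ltnW lt_N.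
by exists n.
Qed.

Lemma letters_s_bound :
  exists B, forall c, isS c -> forall n, size (sit n c) <= B.
Proof.
apply: uniform_bound => [a m n mn H aS k|a].
  exact: leq_trans (H aS k) mn.
have [/letters_sP[B aB]|naS] := pselect (isS a); first by exists B.
by exists 0.
Qed.

Lemma size_ext_word_s B n u : (forall c, isS c -> forall n, size (sit n c) <= B) ->
  word_s u -> size (ext n u) <= B * size u.
Proof.
move=> HB; elim: u => [|c u IH] us; first by rewrite ext_nil.
rewrite ext_cons size_cat mulnS; apply: leq_add.
  by apply: HB; apply: us; rewrite mem_head.
by apply: IH => d du; apply: us; rewrite inE du orbT.
Qed.

Lemma letters_s_sit n c d : isS c -> d \in sit n c -> isS d.
Proof.
move=> /letters_sP[B cB] dc; apply/letters_sP; exists B => m.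
by apply: leq_trans (cB (m + n)); rewrite sitD; exact/size_infix/infix_sit.
Qed.

Lemma word_s_cat u v : word_s (u ++ v) <-> word_s u /\ word_s v.
Proof.
split=> [uvs|[us vs] c]; last by rewrite mem_cat => /orP[/us|/vs].
by split=> c cu; apply: uvs; rewrite mem_cat cu ?orbT.
Qed.

Lemma word_s_ext n u : word_s u -> word_s (ext n u).
Proof. by move=> us c /mem_ext[d du]; apply: letters_s_sit; exact: us. Qed.

Lemma first_letter_l w :
  word_s w \/ exists u b z, [/\ w = u ++ b :: z, word_s u & isL b].
Proof.
elim: w => [|c w IH]; first by left.
have [cL|cS] := pselect (isL c); first by right; exists [::], c, w.
case: IH => [ws|[u [b [z [-> us bL]]]]].
  by left=> d; rewrite inE => /orP[/eqP->|/ws].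
right; exists (c :: u), b, z; split=> // d.
by rewrite inE => /orP[/eqP->|/us].
Qed.

Lemma not_word_s w : ~ word_s w -> exists2 b, b \in w & isL b.
Proof.
case: (first_letter_l w) => // -[u [b [z [-> _ bL]]]] _.
by exists b => //; rewrite mem_cat mem_head orbT.
Qed.

Lemma size_prefix_word_s w u b z :
  prefix w (u ++ b :: z) -> word_s w -> isL b -> size w <= size u.
Proof.
move=> /prefixP[q E] ws bL; rewrite leqNgt; apply/negP => lt_uw.
apply: (ws b) => //; have := congr1 (fun s => nth b s (size u)) E.
rewrite nth_cat ltnn subnn /= nth_cat lt_uw => ->; exact: mem_nth.
Qed.

Lemma first_letter_inj u b z u' b' z' :
  word_s u -> word_s u' -> isL b -> isL b' ->
  u ++ b :: z = u' ++ b' :: z' -> [/\ u = u', b = b' & z = z'].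
Proof.
move=> us us' bL bL' E.
have szu : size u = size u'.
  by apply/eqP; rewrite eqn_leq (@size_prefix_word_s u u' b' z') -?E
    ?prefix_prefix //= (@size_prefix_word_s u' u b z) ?E ?prefix_prefix.
by move: E => /eqP; rewrite eqseq_cat // => /andP[/eqP-> /eqP[-> ->]].
Qed.

(** If all letters of some iterate were bounded, every later iterate would have length at most [B]
    times that of this one. *)
Lemma word_s_sit n a : isL a -> ~ word_s (sit n a).
Proof.
move=> /letters_lP aL as_; have [B HB] := letters_s_bound.
have [m] := aL (B * size (sit n a)).+1; apply/negP; rewrite -leqNgt.
apply: leq_trans (size_ext_word_s m HB as_); rewrite -sitD.
by apply: size_sit_le; exact: leq_addr.
Qed.

Lemma letters_l_sit n a : isL a -> exists2 b, b \in sit n a & isL b.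
Proof. by move=> aL; apply/not_word_s/word_s_sit. Qed.

Lemma letters_l_pred n a b : b \in sit n a -> isL b -> isL a.
Proof.
by move=> ba bL; apply: contrapT => /letters_s_sit-/(_ n b ba); apply.
Qed.

(* The first growing letters of the [sigma^n(a)] eventually repeat, and a
   repeated one starts its own iterated image since it is not left-isolated. *)
Lemma prefix_word_s_bound :
  (forall a, isL a -> ~ left_isolated sigma a) ->
  exists P, forall a, isL a -> forall n w,
    prefix w (sit n a) -> word_s w -> size w <= P.
Proof.
move=> nleft; apply: uniform_bound => [a m n mn H aL k w ? ?|a].
  exact: leq_trans (H aL k w _ _) mn.
have [aL|naL] := pselect (isL a); last by exists 0.
have [B HB] := letters_s_bound.
have first n : exists ubz : seq A * A * seq A,
    [/\ sit n a = ubz.1.1 ++ ubz.1.2 :: ubz.2, word_s ubz.1.1 & isL ubz.1.2].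
  case: (first_letter_l (sit n a)) => [/word_s_sit//|[u [b [z ?]]]].
  by exists (u, b, z).
have [f fP] := choice first.
have [i [j [lt_ij eb]]] := nat_fin_collision (fun n => (f n).1.2).
have [Ei ui_s bL] := fP i; set u := (f i).1.1 in Ei ui_s.
set b := (f i).1.2 in Ei bL eb; set z := (f i).2 in Ei.
have [Ej uj_s bjL] := fP j; rewrite -eb in Ej.
pose r := j - i; have r_gt0 : 0 < r by rewrite subn_gt0.
(* The first growing letter of [sit r b] is also that of [sit j a], namely [b]; a nonempty bounded
   word before it would make [b] left-isolated. *)
have [z' br] : exists z', sit r b = b :: z'.
  case: (first_letter_l (sit r b)) => [/word_s_sit//|[u' [b' [z' [E u's b'L]]]]].
  have jE : j = r + i by rewrite subnK // ltnW.
  move: Ej; rewrite [in sit j _]jE sitD Ei ext_cat ext_cons E -!catA catA.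
  move=> /first_letter_inj[] //; first by apply/word_s_cat; split=> //; exact: word_s_ext.
  move=> _ bb' _; case: u' E u's => [E _|c u' E u's]; first by exists z'; rewrite bb'.
  by case: (nleft b bL); exists r, (c :: u'), z'; rewrite E bb'.
have bk k : exists z'', sit (k * r) b = b :: z''.
  elim: k => [|k [z'' IH]]; first by exists [::].
  by rewrite mulSn sitD IH ext_cons br; eexists.
(* A nonempty bounded prefix of [sit n b] would persist up to [sit (n * r) b], which starts with the
   growing letter [b]. *)
have bn n : exists d y, sit n b = d :: y /\ isL d.
  case: (first_letter_l (sit n b)) => [/word_s_sit//|[u' [d [y [E u's dL]]]]].
  case: u' E u's => [->|c u' E u's]; first by exists d, y.
  have [z'' kE] := bk n; exfalso.
  have : prefix (ext (n * r - n) (c :: u')) (b :: z'').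
    rewrite -kE -{2}(@subnK n (n * r)) ?leq_pmulr // sitD; apply: prefix_ext.
    by rewrite E prefix_prefix.
  move=> /(@size_prefix_word_s _ [::])/(_ (word_s_ext u's) bL).
  by rewrite leqn0 size_eq0 => /eqP/ext_nil_eq.
(* From [i] on, the bounded prefix is exactly an image of [u], of length at most [B * size u];
   before [i], the whole word is short. *)
exists (maxn (B * size u) (size (sit i a))) => _ n w wp ws.
have [le_in|/ltnW le_ni] := leqP i n; rewrite leq_max; apply/orP; last first.
  by right; apply: leq_trans (size_prefix wp) (size_sit_le _ le_ni).
left; apply: leq_trans (size_ext_word_s (n - i) HB ui_s).
have [d [y [dE dL]]] := bn (n - i).
move: wp; rewrite -{1}(subnK le_in) sitD Ei ext_cat ext_cons dE /= => wp.
exact: size_prefix_word_s wp ws dL.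
Qed.

(* Iterating [sigma^n(a) = u a w] piles up the words [sigma^kn(u)], which are
   eventually periodic in k since u does not grow. *)
Lemma left_isolated_powers a : left_isolated sigma a ->
  exists2 v, v != [::] & forall m, exists k, 1 <= k /\
    infix (flatten (nseq m v)) (sit k a).
Proof.
move=> [n [u [w [n_gt0 u_ne us E]]]]; have [B HB] := letters_s_bound.
(* All iterates of [u] fit in this finite type, so the default value of [insub_bseq] never
   occurs. *)
pose f k : (B * size u).-bseq A := insub_bseq _ (ext (k * n) u).
have [i [j [lt_ij fij]]] := nat_fin_collision f.
have {f fij} uij : ext (i * n) u = ext (j * n) u.
  have := congr1 val fij; rewrite /f /insub_bseq.
  by rewrite !val_insubd !(size_ext_word_s _ HB us).
pose p := j - i; have p_gt0 : 0 < p by rewrite subn_gt0.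
(* [W] is the product of the iterates of [u] accumulated to the left of [a]; the last clause says
   that whatever fixes [ext (i * n) u] also fixes [ext (i * n) W]. *)
have aE k : exists W Z, [/\ sit (k * n) a = W ++ a :: Z, k = 0 \/ W != [::]
    & forall m, ext (m * n) (ext (i * n) u) = ext (i * n) u ->
      ext (m * n) (ext (i * n) W) = ext (i * n) W].
  elim: k => [|k [W [Z [kE _ WP]]]].
    by exists [::], [::]; split=> [||m _]; [|left|rewrite !ext_nil].
  exists (ext (k * n) u ++ W), (Z ++ ext (k * n) w); split.
  - by rewrite mulSn addnC sitD E ext_cat ext_cons kE -!catA.
  - right; case: (ext (k * n) u) (@ext_nil_eq (k * n) u) => [/(_ erefl) e|//].
    by rewrite e in u_ne.
  - move=> m mu; rewrite !ext_cat (WP _ mu); congr (_ ++ _).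
    have comm x y : ext x (ext y u) = ext y (ext x u) by rewrite -!iterD addnC.
    by rewrite [ext (i * n) _]comm -[LHS]iterD addnC iterD -[in LHS]iterD iterD mu.
have [W [Z [pE Wne WP]]] := aE p.
case: Wne => [p0|Wne]; first by rewrite p0 in p_gt0.
have {}WP : ext (p * n) (ext (i * n) W) = ext (i * n) W.
  by apply: WP; rewrite -iterD -mulnDl subnK // ltnW.
set v := ext (i * n) W in WP.
exists v; first by apply: contraNneq Wne => /ext_nil_eq ->.
(* The power p * n of sigma fixes [v], and each further application of it inserts one more copy of
   [v] before [sit (i * n) a]. *)
have powE m : exists Z', sit (m * (p * n) + i * n) a =
    flatten (nseq m v) ++ sit (i * n) a ++ Z'.
  elim: m => [|m [Z' IH]]; first by exists [::]; rewrite cats0.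
  exists (ext (i * n) Z ++ ext (p * n) Z').
  rewrite {1}mulSn -addnA sitD IH !ext_cat -sitD.
  have -> : ext (p * n) (flatten (nseq m v)) = flatten (nseq m v).
    by elim: m {IH} => [|m IHm] /=; rewrite ?ext_nil // ext_cat WP IHm.
  rewrite -(addn1 m) nseqD flatten_cat /= cats0 (addnC (p * n)) sitD pE.
  by rewrite ext_cat ext_cons -/v -!catA.
(* Using [m.+1] keeps the exponent positive even if [m] and [i] vanish. *)
move=> m; have [Z' mE] := powE m.+1; exists (m.+1 * (p * n) + i * n); split.
  by rewrite mulSn -addnA ltn_addr // muln_gt0 p_gt0.
rewrite mE -addn1 nseqD flatten_cat -!catA; exact: prefix_infix.
Qed.

End Words.

(** * Tame l-primitive substitutions *)

Section Reversal.
Variables (A : finType) (sigma : A -> seq A).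
Local Notation rsigma := (fun a => rev (sigma a)).

(** Reversing all images exchanges left and right, so the results on left-isolated letters also
    serve for right-isolated ones. *)
Lemma subst_iter_rev n a : subst_iter rsigma n a = rev (subst_iter sigma n a).
Proof.
elim: n => // n IH.
have iterS' (s : A -> seq A) : subst_iter s n.+1 a = subst_ext s (subst_iter s n a) by [].
by rewrite !iterS' IH /subst_ext rev_flatten -map_comp -map_rev.
Qed.

Lemma letters_l_rev : letters_l rsigma = letters_l sigma.
Proof.
have e a : (fun n => size (subst_iter rsigma n a)) = (fun n => size (subst_iter sigma n a)).
  by apply/funext => n; rewrite subst_iter_rev size_rev.
by apply/funext => a; rewrite /letters_l /mkset e.
Qed.

Lemma word_s_rev u : word_s rsigma u <-> word_s sigma u.
Proof. by rewrite /word_s /letters_s letters_l_rev. Qed.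

Lemma left_isolated_rev a : left_isolated rsigma a <-> right_isolated sigma a.
Proof.
have rev0 (u : seq A) : u != [::] -> rev u != [::].
  by apply: contraNneq => /(congr1 rev); rewrite revK => ->.
split=> [[n [u [w [n_gt0 u0 us E]]]]|[n [w [u [n_gt0 u0 us E]]]]].
  exists n, (rev w), (rev u); split=> //; first exact: rev0.
    by move=> c; rewrite mem_rev; move/word_s_rev: us; exact.
  by rewrite -[LHS]revK -subst_iter_rev E rev_cat rev_cons cat_rcons.
exists n, (rev u), (rev w); split=> //; first exact: rev0.
  by apply/word_s_rev => c; rewrite mem_rev; exact: us.
by rewrite subst_iter_rev E rev_cat rev_cons cat_rcons.
Qed.

End Reversal.

Section Tame.
Variables (A : finType) (sigma : A -> seq A).
Hypothesis sigma_ne : forall a, sigma a != [::].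
Local Notation ext n w := (iter n (subst_ext sigma) w).
Local Notation sit n a := (subst_iter sigma n a).
Local Notation isL := (letters_l sigma).
Local Notation isS := (letters_s sigma).
Local Notation word_s := (word_s sigma).

Let rsigma_ne a : rev (sigma a) != [::].
Proof. by rewrite -size_eq0 size_rev size_eq0. Qed.

Lemma suffix_word_s_bound :
  (forall a, isL a -> ~ right_isolated sigma a) ->
  exists Q, forall a, isL a -> forall n w,
    suffix w (sit n a) -> word_s w -> size w <= Q.
Proof.
move=> nright.
have [a aL /left_isolated_rev|Q HQ] := prefix_word_s_bound rsigma_ne.
  by apply: nright; rewrite -letters_l_rev.
exists Q => a aL n w wsuf ws; rewrite -size_rev; apply: (HQ a) (n) _ _ _.
- by rewrite letters_l_rev.
- by rewrite subst_iter_rev prefix_rev.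
- by apply/word_s_rev => c; rewrite mem_rev; exact: ws.
Qed.

Lemma not_tame_powers : ~ tame sigma ->
  exists2 v, v != [::] & forall m, language sigma (flatten (nseq m v)).
Proof.
move=> /existsNP[a /not_implyP[aL /not_andP[|] /contrapT]].
  move=> /(left_isolated_powers sigma_ne)[v v0 vP]; exists v => // m.
  by have [k [k1 vk]] := vP m; exists a, k.
move=> /left_isolated_rev/(left_isolated_powers rsigma_ne)[v v0 vP].
exists (rev v) => [|m]; first by rewrite -size_eq0 size_rev size_eq0.
have [k [k1]] := vP m; rewrite subst_iter_rev -infix_revLR => vk.
exists a, k; split=> //; congr infix: vk.
by rewrite rev_flatten map_nseq rev_nseq.
Qed.

(* A factor of [sigma^n(sigma(a))] without growing letters either lies in some
   [sigma^n(c)], or is a suffix of such a word followed by images of few letters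
   and a prefix of such a word. *)
Lemma word_s_bound : tame sigma ->
  exists G, forall a n w, infix w (sit n a) -> word_s w -> size w <= G.
Proof.
move=> tm; have [B HB] := letters_s_bound sigma_ne.
have [P HP] := prefix_word_s_bound sigma_ne (fun a aL => (tm a aL).1).
have [Q HQ] := suffix_word_s_bound (fun a aL => (tm a aL).2).
pose M := \max_a size (sigma a).
(* Each leading bounded letter of [z] contributes at most [B]; the first growing one contributes at
   most [P] and stops the prefix. *)
have pre n z w : prefix w (ext n z) -> word_s w -> size w <= P + B * size z.
  elim: z w => [|c z IH] w.
    by rewrite ext_nil => /size_prefix; rewrite leqn0 => /eqP->.
  rewrite ext_cons => /prefixP[q E] ws.
  have [cL|cS] := pselect (isL c).
    case: (first_letter_l sigma (sit n c)) => [/(word_s_sit sigma_ne cL)//|].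
    move=> [u [b [y [cE us bL]]]]; rewrite cE -catA /= in E.
    apply: (@leq_trans P); last exact: leq_addr.
    apply: leq_trans (HP c cL n u _ us); last by rewrite cE prefix_prefix.
    apply: size_prefix_word_s (y ++ ext n z) _ ws bL.
    by rewrite E prefix_prefix.
  have cB := HB c cS n; rewrite /= mulnS.
  have [le_wc|/ltnW le_cw] := leqP (size w) (size (sit n c)).
    by apply: leq_trans le_wc (leq_trans cB _); rewrite addnCA leq_addr.
  have [s [wE sE]] := cat_eq_prefix E le_cw.
  have : size s <= P + B * size z.
    apply: IH; first by rewrite sE prefix_prefix.
    by move: ws; rewrite wE => /word_s_cat[].
  by rewrite wE size_cat addnCA; exact: leq_add.
(* For a straddling factor, [B + Q] bounds the part in the first image and [P + B * M] the part
   after it. *)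
pose G := B + Q + P + B * M.
have step n : (forall a w, infix w (sit n a) -> word_s w -> size w <= G) ->
    forall z w, size z <= M -> infix w (ext n z) -> word_s w -> size w <= G.
  move=> IHn; elim=> [|c z IH] w szM.
    by rewrite ext_nil => /size_infix; rewrite leqn0 => /eqP->.
  rewrite ext_cons => /infixP[p [q /esym/infix_catE]] + ws.
  have szz : size z <= M by apply: ltnW.
  case=> [[r E]|[r E]|[w1 [w2 [wE cE zE]]]].
  - by apply: (IHn c) ws; rewrite E infix_infix.
  - by apply: IH ws => //; rewrite E infix_infix.
  - move: ws; rewrite wE => /word_s_cat[w1s w2s]; rewrite size_cat.
    have sz2 : size w2 <= P + B * size z.
      by apply: (pre n z w2) w2s; rewrite zE prefix_prefix.
    have sz1 : size w1 <= B + Q.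
      have [cL|cS] := pselect (isL c).
        by apply: leq_trans (HQ c cL n w1 _ w1s) (leq_addl _ _); rewrite cE suffix_suffix.
      by apply: leq_trans (leq_trans (HB c cS n) (leq_addr _ _)); rewrite cE size_cat leq_addl.
    have : B * size z <= B * M by rewrite leq_mul2l szz orbT.
    by rewrite /G; lia.
(* Induction peels off the innermost application of sigma, so the bound [G] does not depend on
   [n]. *)
exists G => a n; elim: n a => [|n IHn] a w wa ws; last first.
  apply: (step n IHn (sigma a)) => //; first exact: leq_bigmax.
  by move: wa; rewrite -addn1 sitD /subst_iter /= /subst_ext /= cats0.
have [aL|aS] := pselect (isL a).
  case: w wa ws => // c w; move=> /mem_infix/(_ c (mem_head _ _)).
  by rewrite inE => /eqP-> /(_ a (mem_head _ _)).
apply: leq_trans (size_infix wa) (leq_trans (HB a aS 0) _).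
by rewrite /G; lia.
Qed.

End Tame.

Section TamePrimitive.
Variables (A : finType) (sigma : A -> seq A).
Hypotheses (sub : substitution sigma) (tm : tame sigma) (prim : l_primitive sigma).
Local Notation ext n w := (iter n (subst_ext sigma) w).
Local Notation sit n a := (subst_iter sigma n a).
Local Notation isL := (letters_l sigma).
Local Notation isS := (letters_s sigma).
Local Notation word_s := (word_s sigma).

Let sigma_ne a : sigma a != [::].
Proof. by case: sub. Qed.

Lemma letter_from_l c : exists a k, isL a /\ c \in sit k a.
Proof.
have [cL|cS] := pselect (isL c); first by exists c, 0; rewrite mem_head.
case: sub => _ _ iso0; apply: contrapT => nex.
suff : letters_iso sigma c by rewrite iso0.
by split=> // a n aL _; apply/negP => ca; apply: nex; exists a, n.
Qed.

(** A long iterate of a growing letter is cut into p, s, q with s longer than [G], so s contains a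
    growing letter [d]. A suitable power of sigma puts [c] into the image of [d] and does not
    shorten p and q. *)
Lemma letter_extends c K :
  exists p q, [/\ language sigma (p ++ c :: q), K <= size p & K <= size q].
Proof.
have [G HG] := word_s_bound sigma_ne tm.
have [_ [a0 a0L] _] := sub.
have [n0 szn0] := (letters_lP sigma_ne a0).1 a0L (K + (G.+1 + K)).
have [a [k [aL ca]]] := letter_from_l c.
have [N N_gt0 HN] := prim.
set w := sit n0 a0 in szn0.
have := cat_take_drop K w; rewrite -{1}(cat_take_drop G.+1 (drop K w)).
set p := take K w; set s := take _ _; set q := drop _ _ => wE.
have szp : size p = K by rewrite size_takel //; lia.
have szs : size s = G.+1 by rewrite size_takel // size_drop; lia.
have szq : K <= size q by rewrite !size_drop; lia.
have [d ds dL] : exists2 d, d \in s & isL d.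
  apply: not_word_s => ws; have := HG a0 n0 s _ ws.
  by rewrite szs ltnn -/w -wE infix_infix => /(_ isT).
have : c \in sit (k + N) d.
  by rewrite sitD; apply/mem_ext; exists a => //; exact: HN.
rewrite -infix1s => /infixP[p1 [q1 dE]].
move: ds; rewrite -infix1s => /infixP[s1 [s2 sE]].
have wE' : w = (p ++ s1) ++ d :: (s2 ++ q) by rewrite -wE sE -!catA.
exists (ext (k + N) (p ++ s1) ++ p1), (q1 ++ ext (k + N) (s2 ++ q)); split.
- exists a0, (k + N + n0); split; first by rewrite addn_gt0 addn_gt0 N_gt0 orbT.
  by rewrite sitD -/w wE' [in X in infix _ X]ext_cat ext_cons dE -!catA infix_refl.
- rewrite size_cat; apply: leq_trans (leq_addr _ _).
  by apply: leq_trans (size_ext_ge sigma_ne _ _); rewrite size_cat szp leq_addr.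
- rewrite size_cat; apply: leq_trans (leq_addl _ _).
  apply: leq_trans (size_ext_ge sigma_ne _ _).
  by rewrite size_cat; apply: leq_trans szq (leq_addl _ _).
Qed.

Lemma X_subst_letter c : exists2 x, X_subst sigma x & x 0%R = c.
Proof.
apply: X_of_extend => [u v uv [a [n [n1 va]]]|K]; last exact: letter_extends.
by exists a, n; split=> //; exact: infix_trans va.
Qed.

(** A long word contains the image under the power m + N of a word of length G + 1. The latter has a
    growing letter, whose N-th iterate contains [a]. *)
Lemma uniform_recurrence a m : isL a ->
  exists K, forall w, language sigma w -> K < size w -> infix (sit m a) w.
Proof.
move=> aL; have [G HG] := word_s_bound sigma_ne tm; have [N N_gt0 HN] := prim.
pose M := \max_b size (sit (m + N) b).
have szM b : size (sit (m + N) b) <= M.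
  exact: (@leq_bigmax _ (fun b => size (sit (m + N) b))).
exists (M * G.+2) => w [b [n [_ wb]]] szw.
have [le_n|/ltnW le_n] := leqP n (m + N).
  suff : size w <= M * G.+2 by rewrite leqNgt szw.
  apply: leq_trans (size_infix wb) (leq_trans (size_sit_le sigma_ne b le_n) _).
  by apply: leq_trans (szM b) _; rewrite leq_pmulr.
move: wb; rewrite -(subnKC le_n) sitD ext_flatten.
move=> /(infix_desubst szM)/(_ szw)[z [zb szz zw]].
have [d dz dL] : exists2 d, d \in z & isL d.
  by apply: not_word_s => /(HG _ _ _ zb); rewrite szz ltnn.
apply: infix_trans zw; rewrite -ext_flatten.
apply: infix_trans (infix_sit sigma (m + N) dz).
by rewrite sitD; apply: infix_sit; exact: HN.
Qed.

Lemma tame_primitive_minimal : minimal_subshift (X_subst sigma).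
Proof.
split; first exact: subshift_X_of.
move=> L subL [x Lx] LX; apply/seteqP; split=> // y Xy.
apply: (iffLR (closed_windowP L) subL.1) => s n.
have [b [k [_ yb]]] : language sigma (window y s n.+2).
  by move/X_ofP: Xy; apply.
have [a [j [aL ba]]] := letter_from_l b.
have [K HK] := uniform_recurrence (k + j) aL.
have : infix (window y s n) (window x 0 K.+2).
  apply: (@infix_trans _ (sit (k + j) a)); last first.
    apply: HK; last by rewrite size_mkseq.
    exact: (iffLR (X_ofP (language sigma) x) (LX x Lx)).
  apply: infix_trans (infix_trans _ yb) _.
    by rewrite -addn2 windowD prefix_infix.
  by rewrite sitD infix_sit.
move=> /infix_window/(_ (size_mkseq _ _))[i [_ ->]].
(* Translate [x] so that the occurrence found at [i] moves to [s]. *)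
exists (fun l => x (l + (i%:Z - s))%R).
  exact: (subshift_translate (i%:Z - s)%R subL Lx).
by rewrite window_shift addrC subrK add0r.
Qed.

End TamePrimitive.

(** * Minimal substitution subshifts *)

(** This is the language of the periodic sequence v^oo. *)
Definition power_factors (T : eqType) (v : seq T) : set (seq T) :=
  [set w | exists m, infix w (flatten (nseq m v))].

Lemma power_factors_map (T T' : eqType) (f : T -> T') (v : seq T) :
  map f @` power_factors v = power_factors (map f v).
Proof.
apply/seteqP; split=> [_ [w [m /infixP[p [q E]]] <-]|w [m]]; first exists m;
  rewrite -map_nseq -map_flatten.
  by rewrite E !map_cat infix_infix.
move=> /infixP[p [q E]].
exists (take (size w) (drop (size p) (flatten (nseq m v)))).
  by exists m; exact: infix_trans (infix_take _ _) (infix_drop _ _).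
by rewrite map_take map_drop E drop_size_cat // take_size_cat.
Qed.

Lemma power_factors_point (A : finType) (v : seq A) :
  v != [::] -> X_of (power_factors v) !=set0.
Proof.
case: v => // c v _; have [|//|x Xx _] := @X_of_extend _ (power_factors (c :: v)) c.
  by move=> u w uw [m wm]; exists m; exact: infix_trans wm.
  move=> K; have szK : K <= size (flatten (nseq K (c :: v))).
    by rewrite size_flatten /shape map_nseq sumn_nseq /= mulSn leq_addr.
  exists (flatten (nseq K (c :: v))), (v ++ flatten (nseq K (c :: v))); split=> //.
    exists (K + K.+1); rewrite nseqD flatten_cat; exact: infix_refl.
  by rewrite size_cat; apply: leq_trans szK (leq_addl _ _).
by exists x.
Qed.

(** * The periodic case *)

Section ConstantSubstitution.
Variables (D : finType) (v : seq D).
Hypotheses (v_full : forall d, d \in v) (v_gt1 : 1 < size v).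
Local Notation rho := (fun _ : D => v).

Lemma subst_iter_const n d : subst_iter rho n.+1 d = flatten (nseq (size v ^ n) v).
Proof.
have extE w : subst_ext rho w = flatten (nseq (size w) v).
  by elim: w => //= a w IH; rewrite -IH.
elim: n => [|n IH]; first by rewrite /subst_iter /= extE.
rewrite -addn1 addnC sitD IH /= extE; congr (flatten (nseq _ _)).
by rewrite size_flatten /shape map_nseq sumn_nseq expnS mulnC.
Qed.

Let v_ne : v != [::].
Proof. by case: v v_gt1. Qed.

Lemma letters_l_const d : letters_l rho d.
Proof.
apply/(letters_lP (fun=> v_ne)) => N; exists N.+1; rewrite subst_iter_const.
rewrite size_flatten /shape map_nseq sumn_nseq.
apply: leq_trans (leq_pmull _ (ltnW v_gt1)).
exact: ltnW (ltn_expl _ v_gt1).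
Qed.

(** The exponents [size v ^ n] are unbounded because [1 < size v]; the letter [d] only provides a
    word to iterate on. *)
Lemma language_const (d : D) : language rho = power_factors v.
Proof.
apply/seteqP; split=> [w [a [[|n] [// _]]]|w [m wm]].
  by rewrite subst_iter_const => wv; exists (size v ^ n).
exists d, m.+1; split=> //; rewrite subst_iter_const.
rewrite -(subnKC (ltnW (ltn_expl m v_gt1))) nseqD flatten_cat.
exact: infix_catr.
Qed.

Lemma constant_substitution (d : D) :
  [/\ substitution rho, tame rho & l_primitive rho].
Proof.
have word_s0 u : word_s rho u -> u = [::].
  by case: u => // c u /(_ c (mem_head _ _)); have := letters_l_const c.
split.
- split=> //; first by exists d; exact: letters_l_const.
  by apply/seteqP; split=> // b [+ _]; have := letters_l_const b.
- move=> a _; split=> -[n [u [w [_ u0 ws _]]]].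
    by rewrite (word_s0 _ ws) in u0.
  by rewrite (word_s0 _ ws) in u0.
- by exists 1 => // a b _ _; rewrite subst_iter_const /= cats0.
Qed.

End ConstantSubstitution.

(** * Primitive classes of growing letters *)

Section Core.
Variables (A : finType) (sigma : A -> seq A).
Hypothesis sigma_ne : forall a, sigma a != [::].
Local Notation sit n a := (subst_iter sigma n a).
Local Notation isL := (letters_l sigma).

(* [S n a] is the set of growing letters of [sigma^n(a)].  For [d] such that
   [S d] is idempotent, a smallest nonempty [S d a] is the wanted class. *)
Lemma primitive_class : (exists a, isL a) ->
  exists d (C : {set A}), [/\ 0 < d, C != finset.set0, forall a, a \in C -> isL a
    & forall n a b, 0 < n -> a \in C -> isL b -> (b \in sit (n * d) a) = (b \in C)].
Proof.
move=> [a0 a0L].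
pose S n : {ffun A -> {set A}} :=
  [ffun a => [set b | (b \in sit n a) && `[< isL b >]]%SET].
have SP n a b : (b \in S n a) = (b \in sit n a) && `[< isL b >].
  by rewrite ffunE inE.
(* A letter with a growing letter in an iterated image is itself growing, so intermediate letters
   stay in the sets [S]. *)
have SD n m a b : b \in S (n + m) a <-> exists2 c, c \in S m a & b \in S n c.
  rewrite SP sitD; split=> [/andP[/mem_ext[c cm bc] /asboolP bL]|].
    have cL := letters_l_pred sigma_ne bc bL.
    by exists c; rewrite SP ?cm ?bc; apply/asboolP.
  move=> [c]; rewrite !SP => /andP[cm _] /andP[bc ->]; rewrite andbT.
  by apply/mem_ext; exists c.
have [i [j [lt_ij Sij]]] := nat_fin_collision S.
pose p := j - i; have p_gt0 : 0 < p by rewrite subn_gt0.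
have Sp k : S (k + i + p) = S (k + i).
  rewrite -addnA subnKC ?(ltnW lt_ij) //; apply/ffunP => a; apply/setP => b.
  by apply/idP/idP => /SD[c ca bc]; apply/SD; exists c; rewrite ?Sij // -Sij.
(* A multiple of the period [p] beyond the preperiod [i]: [S] takes the same value at all positive
   multiples of [d]. *)
pose d := i.+1 * p.
have le_id : i <= d by rewrite /d; apply: leq_trans (leq_pmulr _ p_gt0); exact: leqnSn.
have Sd m : S (d + m * p) = S d.
  elim: m => [|m IH]; first by rewrite addn0.
  rewrite mulSn (addnC p) addnA.
  have -> : d + m * p = (d + m * p - i) + i by rewrite subnK // (leq_trans le_id) ?leq_addr.
  by rewrite Sp subnK // (leq_trans le_id) ?leq_addr.
have Sn n : 0 < n -> S (n * d) = S d.
  by case: n => // n _; rewrite mulSn {2}/d mulnA Sd.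
case: (@arg_minnP _ a0 (fun a => `[< isL a >]) (fun a => #|S d a|)).
  exact/asboolP.
move=> a /asboolP aL amin; exists d, (S d a); split.
- by rewrite muln_gt0.
- have [b ba bL] := letters_l_sit sigma_ne d aL.
  by apply/set0Pn; exists b; rewrite SP ba; apply/asboolP.
- by move=> b; rewrite SP => /andP[_ /asboolP].
move=> n b c n_gt0 bC cL.
have bL : `[< isL b >] by move: bC; rewrite SP => /andP[].
(* Idempotence gives inclusion of [S d b] in [S d a], and minimal cardinality gives equality. *)
have <- : S d b = S d a.
  apply/eqP; rewrite eqEcard amin // andbT; apply/fintype.subsetP => e eb.
  by rewrite -(Sn 2) // mul2n -addnn; apply/SD; exists b.
by rewrite -(Sn n) // SP; move/asboolP: cL => ->; rewrite andbT.
Qed.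

End Core.

(** * Restricting a power of sigma to a smaller alphabet *)

Section Restriction.
Variables (A B : finType) (sigma : A -> seq A) (tau : B -> seq B).
Variables (iota : B -> A) (d : nat).
Hypotheses (sigma_ne : forall a, sigma a != [::]) (d_gt0 : 0 < d).
Hypothesis tauE : forall b, map iota (tau b) = subst_iter sigma d (iota b).

Lemma subst_iter_restr n b :
  map iota (subst_iter tau n b) = subst_iter sigma (n * d) (iota b).
Proof.
elim: n => // n IH; rewrite mulSn sitD -IH.
have -> : subst_iter tau n.+1 b = subst_ext tau (subst_iter tau n b) by [].
elim: (subst_iter tau n b) => [|c w IHw]; first by rewrite ext_nil.
by rewrite /= ext_cons -IHw -tauE /subst_ext /= map_cat.
Qed.

Lemma restriction_ne b : tau b != [::].
Proof.
rewrite -size_eq0 -(size_map iota) tauE size_eq0.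
by apply/eqP => /(ext_nil_eq sigma_ne).
Qed.

Lemma letters_l_restr b : letters_l tau b <-> letters_l sigma (iota b).
Proof.
split=> [/(letters_lP restriction_ne) H|/(letters_lP sigma_ne) H].
  apply/(letters_lP sigma_ne) => N; have [n] := H N.
  by rewrite -(size_map iota) subst_iter_restr => nN; exists (n * d).
apply/(letters_lP restriction_ne) => N; have [n nN] := H N; exists n.
rewrite -(size_map iota) subst_iter_restr; apply: leq_trans nN _.
exact/size_sit_le/leq_pmulr.
Qed.

End Restriction.

Lemma lift_word (U : choiceType) (B : {fset U}) (w : seq U) :
  (forall u, u \in w -> u \in B) -> exists w' : seq B, map val w' = w.
Proof.
elim: w => [|u w IH] uB; first by exists [::].
have [|w' w'E] := IH; first by move=> c cw; apply: uB; rewrite inE cw orbT.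
by exists ([` uB u (mem_head _ _)]%fset :: w'); rewrite /= w'E.
Qed.

Lemma primitive_restriction (U : choiceType) (A : {fset U}) (sigma : A -> seq A) :
  substitution sigma ->
  exists (B : {fset U}) (tau : B -> seq B), [/\ substitution tau, l_primitive tau
    & map val @` language tau `<=` map val @` language sigma].
Proof.
move=> [sigma_ne exL _].
have [d [C [d_gt0 C0 CL CP]]] := primitive_class sigma_ne exL.
(* Requiring [0 < n] makes isolated letters impossible; [C] itself is still included, since its
   letters occur in images of [C]. *)
pose P (c : A) := exists2 a, a \in C & exists2 n, 0 < n & c \in subst_iter sigma (n * d) a.
pose B := [fset u in A | `[< exists2 c : A, val c = u & P c >]]%fset.
have BP (b : B) : exists2 c : A, val c = val b & P c.
  by have := valP b; rewrite !inE => /andP[_ /asboolP].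
have CB c : P c -> val c \in B.
  by move=> Pc; rewrite !inE (valP c); apply/asboolP; exists c.
have /choice[io ioP] : forall b : B, exists c : A, val c = val b /\ P c.
  by move=> b; have [c] := BP b; exists c.
have io_inj : injective io.
  by move=> b b' e; apply: val_inj; rewrite -(ioP b).1 -(ioP b').1 e.
have ioK c : P c -> exists b, io b = c.
  by move=> Pc; exists [` CB c Pc]%fset; apply: val_inj; rewrite (ioP _).1.
have /choice[tau tauE] : forall b : B, exists w : seq B,
    map io w = subst_iter sigma d (io b).
  move=> b; have [a aC [n n_gt0 ban]] := (ioP b).2.
  have [w wE] : exists w : seq B, map val w = map val (subst_iter sigma d (io b)).
    apply: lift_word => _ /mapP[c cb ->]; apply: CB; exists a => //.
    by exists n.+1 => //; rewrite mulSn sitD; apply/mem_ext; exists (io b).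
  exists w; apply: (inj_map val_inj); rewrite -wE -map_comp.
  by apply: eq_map => c; exact: (ioP c).1.
have sitE := subst_iter_restr tauE.
have LE := letters_l_restr sigma_ne d_gt0 tauE.
have CPc c : c \in C -> P c.
  move=> cC; exists c => //; exists 1 => //; rewrite CP //; exact: CL.
(* The growing letters of [tau] thus lie in [C], so a single application of [tau] already witnesses
   l-primitivity. *)
have LC b : letters_l tau b -> io b \in C.
  move=> /LE bL; have [a aC [n n_gt0 ban]] := (ioP b).2.
  by rewrite -(CP n a).
exists B, tau; split.
- split; first exact: (restriction_ne sigma_ne tauE).
    have /set0Pn[c cC] := C0; have [b bE] := ioK c (CPc c cC).
    by exists b; apply/LE; rewrite bE; exact: CL.
  apply/seteqP; split=> // b [_ /= bn].
  have [a aC [n n_gt0 ban]] := (ioP b).2.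
  have [a' a'E] := ioK a (CPc a aC).
  have a'L : letters_l tau a' by apply/LE; rewrite a'E; exact: CL.
  by have := bn a' n a'L n_gt0; rewrite -(mem_map io_inj) sitE a'E ban.
- exists 1 => // a b /LC aC /LC bC.
  by rewrite -(mem_map io_inj) sitE CP //; exact: CL.
move=> _ [w [b [n [n_gt0 /infixP[p [q E]]]]] <-].
exists (map io w); last by rewrite -map_comp; apply: eq_map => c; exact: (ioP c).1.
exists (io b), (n * d); split; first by rewrite muln_gt0 n_gt0.
by rewrite -sitE E !map_cat infix_infix.
Qed.

(** Some sequence differs from [b] at some coordinate, which exhibits a second letter of [B]. *)
Lemma card_gt1_of_not_one_letter (U : choiceType) (B : {fset U}) (W : set (int -> B)) :
  (exists b, b \in B) -> ~ one_letter_subshifts U (@embed U B @` W) -> 1 < #|` B|%fset.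
Proof.
move=> [b bB] /forallNP/(_ b)/existsNP[_ /not_implyP[[x Wx <-] /existsNP[i xb]]].
have <- : #|` [fset b; val (x i)]|%fset = 2 by rewrite cardfs2; case: eqP xb => // ->.
apply: fsubset_leq_card; apply/fsubsetP => u; rewrite !inE => /orP[] /eqP-> //.
exact: valP.
Qed.

Lemma minimal_tame_primitive (U : choiceType) :
  substitution_minimal_subshifts U `\` one_letter_subshifts U `<=`
  tame_l_primitive_subshifts U.
Proof.
move=> L [[A [sigma [_ sub min LE]]] nL].
have [B [tau [subt primt sB]]] := primitive_restriction sub.
have [_ [b _] _] := subt.
have [tm|ntm] := pselect (tame tau).
  have L_tau : L = @embed U B @` X_subst tau.
    rewrite LE [RHS](embed_X_of (language tau)); apply: minimal_embedE => //.
    rewrite -(embed_X_of (language tau)); have [x Xx _] := X_subst_letter subt tm primt b.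
    by exists (embed x); exists x.
  exists B, tau; split=> //; apply: (@card_gt1_of_not_one_letter _ _ (X_subst tau)).
    by exists (val b); exact: valP.
  by rewrite -L_tau.
have [v v0 vL] := not_tame_powers (fun a => let: And3 h _ _ := subt in h a) ntm.
have L_v : L = X_of (power_factors (map val v)).
  rewrite LE -power_factors_map; apply: minimal_embedE => //.
    apply: subset_trans sB; apply: image_subset => w [m wm].
    by have [a [n [n1 mn]]] := vL m; exists a, n; split=> //; exact: infix_trans mn.
  rewrite -embed_X_of; have [x Xx] := power_factors_point v0.
  by exists (embed x); exists x.
(* Only the letters of [v] are kept, so that the constant substitution has every letter in its
   image. *)
pose D := [fset u in map val v]%fset.
have [v' v'E] : exists v' : seq D, map val v' = map val v.
  by apply: lift_word => u; rewrite !inE.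
have L_D : L = @embed U D @` X_of (power_factors v').
  by rewrite embed_X_of power_factors_map v'E.
have v'_full d : d \in v'.
  by rewrite -(mem_map val_inj) v'E; have := valP d; rewrite !inE.
have D_gt1 : 1 < #|` D|%fset.
  apply: (@card_gt1_of_not_one_letter _ _ (X_of (power_factors v'))); last by rewrite -L_D.
  by case: v v0 @D {v' v'E L_D v'_full vL L_v} => // c v _; exists (val c); rewrite !inE eqxx.
have v'_gt1 : 1 < size v'.
  apply: leq_trans D_gt1 _; rewrite card_fseq -v'E.
  by rewrite -(size_map val v') size_undup.
have d0 : D by case: v' {v'E L_D v'_full} v'_gt1.
have [? ? ?] := constant_substitution v'_full v'_gt1 d0.
exists D, (fun _ => v'); split=> //.
by rewrite L_D /X_subst (language_const v'_gt1 d0).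
Qed.

Lemma tame_primitive_minimal_subshifts (U : choiceType) :
  tame_l_primitive_subshifts U `<=`
  substitution_minimal_subshifts U `\` one_letter_subshifts U.
Proof.
move=> L [A [sigma [A_gt1 sub tm prim ->]]]; split.
  by exists A, sigma; split=> //; exact: tame_primitive_minimal.
move=> [u Lu].
(* Every letter occurs in [X_subst sigma], so a one-letter subshift would force a one-letter
   alphabet. *)
have Au (c : A) : val c = u.
  have [x Xx <-] := X_subst_letter sub tm prim c.
  by have := Lu _ (ex_intro2 _ _ x Xx erefl) 0%R.
move: A_gt1; rewrite cardfE => /card_gt1P[a [b [_ _ /eqP]]]; apply.
by apply: val_inj; rewrite !Au.
Qed.

Theorem theorem2 (U : choiceType) :
  substitution_minimal_subshifts U `\` one_letter_subshifts U =
  tame_l_primitive_subshifts U.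
Proof.
apply/seteqP; split.
  exact: minimal_tame_primitive.
exact: tame_primitive_minimal_subshifts.
Qed.
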